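(* Let $L,v,k,n>0$, $\tau>0$, $C_{max}>C_{min}>0$ and $\overline{C}\in[C_{min},C_{max}]$ be given. Consider the problem of minimizing the cost $J[C_{A_0}]$ over the class of admissible controls $\mathcal{U}_\tau$ (both defined in the context). 1) If $n=1$, then all controls $C_{A_0}\in\mathcal{U}_\tau$ give the same value of the cost functional $J$. 2) If $n<1$ and $C_{min}>\left(\frac{v}{kL(1-n)}\right)^{-\frac{1}{1-n}}$, then the steady-state control $C_{A_0}(t)\equiv\overline{C}$ is optimal, i.e. it minimizes $J$ over $\mathcal{U}_\tau$. 3) If $n>1$, then for any Lebesgue-measurable set $A^-\subset[0,\tau)$ with Lebesgue measure $\mu(A^-)=\frac{C_{max}-\overline{C}}{C_{max}-C_{min}}\tau$, the control $C_{A_0}=u^\tau$ is optimal, i.e. it minimizes $J$ over $\mathcal{U}_\tau$, where $u(t)=C_{min}$ for $t\in A^-$, $u(t)=C_{max}$ for $t\in A^+=[0,\tau)\setminus A^-$, and $u^\tau:\mathbb{R}\to\mathbb{R}$ is the $\tau$-periodic extension of $u$.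
   Context: The model is the boundary value problem $\frac{\partial C_A}{\partial t}+v\frac{\partial C_A}{\partial x}=-kC_A^n$ for $(x,t)\in[0,L]\times\mathbb{R}$, $C_A(0,t)=C_{A_0}(t)$, with constants $L,v,k,n>0$. For a (possibly discontinuous) control $C_{A_0}$, its (weak) solution is by definition the function $$C_A(x,t)=\left(C_{A_0}\left(t-\tfrac{x}{v}\right)^{-(n-1)}+\tfrac{k(n-1)}{v}x\right)^{-\frac{1}{n-1}}\ \text{ if } n\neq1,\qquad C_A(x,t)=C_{A_0}\left(t-\tfrac{x}{v}\right)e^{-\frac{k}{v}x}\ \text{ if } n=1.$$ The class of admissible controls $\mathcal{U}_\tau$ consists of all measurable $\tau$-periodic functions $C_{A_0}:\mathbb{R}\to[C_{min},C_{max}]$ such that $\frac1\tau\int_0^\tau C_{A_0}(t)\,dt=\overline{C}$. The cost is $$J[C_{A_0}]=\frac1\tau\int_0^\tau C_A(L,t)\,v\,dt,$$ where $C_A$ is the weak solution corresponding to the control $C_{A_0}$, so that $C_A(L,t)=\left(C_{A_0}\left(t-\tfrac{L}{v}\right)^{-(n-1)}+\tfrac{k(n-1)}{v}L\right)^{-\frac{1}{n-1}}$ if $n\neq1$ and $C_A(L,t)=C_{A_0}\left(t-\tfrac{L}{v}\right)e^{-\frac{k}{v}L}$ if $n=1$. *)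

(* Defs.v *)
From HB Require Import structures.
From mathcomp Require Import all_boot all_order all_algebra.
From mathcomp Require Import all_classical all_reals all_analysis.

Set Implicit Arguments.
Unset Strict Implicit.
Unset Printing Implicit Defensive.

Import Order.TTheory GRing.Theory Num.Theory.
Import numFieldNormedType.Exports.
Local Open Scope classical_set_scope.
Local Open Scope ring_scope.

(* [R] with the sigma-algebra of Lebesgue-measurable sets (the domain of
   [completed_lebesgue_measure]); the canonical structure on [R] itself is
   the Borel one. *)
Notation lebesgueTypeR R := (caratheodory_type ((@wlength R idfun)^*)%mu).

Definition lebesgue_measurable (R : realType) (A : set R) : Prop :=
  measurable (A : set (lebesgueTypeR R)).

(* Lebesgue-measurable real function: Borel sets pull back to
   Lebesgue-measurable sets. *)
Definition lebesgue_measurable_fun (R : realType) (u : R -> R) : Prop :=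
  measurable_fun [set: lebesgueTypeR R] (u : lebesgueTypeR R -> R).

(* [powR] returns 1 on a negative base: for n < 1 the formula is the intended
   one only where the bracket is nonnegative. *)
Definition weak_solution (R : realType) (v k n : R) (u : R -> R) (x t : R) : R :=
  if n == 1 then u (t - x / v) * expR (- (k / v) * x)
  else (u (t - x / v) `^ (- (n - 1)) + k * (n - 1) / v * x) `^ (- (n - 1)^-1).

Definition mean (R : realType) (tau : R) (f : R -> R) : R :=
  tau^-1 * \int[@completed_lebesgue_measure R]_(t in `[0, tau]) f t.

Definition admissible (R : realType) (Cmin Cmax Cbar tau : R) (u : R -> R)
    : Prop :=
  [/\ lebesgue_measurable_fun u, periodic u tau,
      forall t, Cmin <= u t <= Cmax & mean tau u = Cbar].

Definition cost (R : realType) (L v k n tau : R) (u : R -> R) : R :=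
  mean tau (fun t => weak_solution v k n u L t * v).

Definition optimal (R : realType) (L v k n Cmin Cmax Cbar tau : R) (u : R -> R)
    : Prop :=
  admissible Cmin Cmax Cbar tau u /\
  forall w, admissible Cmin Cmax Cbar tau w ->
    cost L v k n tau u <= cost L v k n tau w.

(* The tau-periodic function agreeing with [u] on [0, tau[. *)
Definition periodic_extension (R : realType) (tau : R) (u : R -> R) (t : R)
    : R :=
  u (t - (Num.floor (t / tau))%:~R * tau).

(* Only its values on [0, tau[ matter. *)
Definition bang_bang (R : realType) (Cmin Cmax : R) (A : set R) (t : R) : R :=
  if t \in A then Cmin else Cmax.

(* Main.v *)
(** By periodicity and translation invariance of Lebesgue measure, the cost of
a control [u] is [v] times the mean over one period of [G (u t)], where [G] maps
an inlet concentration to the outlet one. With [m = 1 - n] and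
[b = k (n - 1) L / v], [G c = (c^m + b)^(1/m)] has derivative
[(1 + b c^(-m))^(1/m - 1)], so [G] is linear for [n = 1], convex for [n < 1] and
concave for [n > 1]. Hence [G] lies above an affine function, namely its tangent
at [Cbar] when convex and its chord over [[Cmin, Cmax]] when concave. The mean
of an affine function of an admissible control depends on [Cbar] only, so a
control is optimal as soon as it takes its values where [G] meets that line. *)

Require Import Defs.
From HB Require Import structures.
From mathcomp Require Import all_boot all_order all_algebra.
From mathcomp Require Import all_classical all_reals all_analysis.
From mathcomp Require Import measurable_realfun ring lra.
Import Order.TTheory GRing.Theory Num.Theory.
Import numFieldNormedType.Exports.
Local Open Scope classical_set_scope.
Local Open Scope ring_scope.

(** * Tangent and chord inequalities from a monotone derivative *)

(** By the mean value theorem [f x - f c = d e * (x - c)] with [e] between [c] and [x]. On either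
    side of [c], the comparison of [d e] with [d c] and the sign of [x - c] combine to the same
    inequality. *)
Lemma nonincreasing_derive_le_tangent {R : realType} {f d : R -> R} {a b : R} :
  (forall x, a <= x <= b -> is_derive x 1 f (d x)) ->
  (forall x y, a <= x -> x <= y -> y <= b -> d y <= d x) ->
  forall c x, a <= c <= b -> a <= x <= b -> f x <= f c + d c * (x - c).
Proof.
move=> fd dn.
have mvt y z : a <= y -> y <= z -> z <= b ->
    exists2 e, y <= e <= z & f z - f y = d e * (z - y).
  move=> ay yz zb.
  have [|w wyz|e] := @MVT_segment R f d y z yz.
  - by move=> w; rewrite in_itv/= => /andP[yw wz]; apply: fd; lra.
  - apply: derivable_within_continuous => w'.
    rewrite in_itv/= => /andP[yw wz].
    by have [] := fd w' _; [lra|].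
  - by rewrite in_itv/=; exists e.
move=> c x /andP[ac cb] /andP[ax xb].
have [cx|/ltW xc] := leP c x.
  have [e /andP[ce ex]] := mvt c x ac cx xb.
  have : d e <= d c by apply: dn => //; lra.
  by nra.
have [e /andP[xe ec]] := mvt x c ax xc cb.
have : d c <= d e by apply: dn => //; lra.
by nra.
Qed.

Lemma nondecreasing_derive_ge_tangent {R : realType} {f d : R -> R} {a b : R} :
  (forall x, a <= x <= b -> is_derive x 1 f (d x)) ->
  (forall x y, a <= x -> x <= y -> y <= b -> d x <= d y) ->
  forall c x, a <= c <= b -> a <= x <= b -> f c + d c * (x - c) <= f x.
Proof.
move=> fd dn c x cab xab.
have := @nonincreasing_derive_le_tangent R (- f) (- d) a b _ _ c x cab xab.
rewrite !fctE mulNr -opprD lerN2; apply.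
  by move=> y yab; apply: is_deriveN; exact: fd.
by move=> y z ay yz zb; rewrite lerN2 dn.
Qed.

(** The tangent at [x] lies above [f] at both endpoints; weighting these two bounds by [b - x] and
    [x - a] eliminates the slope [d x]. *)
Lemma nonincreasing_derive_ge_chord {R : realType} {f d : R -> R} {a b : R} :
  a < b ->
  (forall x, a <= x <= b -> is_derive x 1 f (d x)) ->
  (forall x y, a <= x -> x <= y -> y <= b -> d y <= d x) ->
  forall x, a <= x <= b ->
    f a + (f b - f a) / (b - a) * (x - a) <= f x.
Proof.
move=> ab fd dn x xab.
have ta := nonincreasing_derive_le_tangent fd dn x a xab ltac:(lra).
have tb := nonincreasing_derive_le_tangent fd dn x b xab ltac:(lra).
rewrite mulrAC -lerBrDl ler_pdivrMr; last lra.
by nra.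
Qed.


(** * The power-law outlet map, its derivative and its monotone slope *)

Section outlet_map.
Context {R : realType}.
Implicit Types (m b c x y : R).

Definition outlet_map m b c := (c `^ m + b) `^ m^-1.
(* The derivative of [outlet_map m b], in a form whose monotonicity is visible. *)
Definition outlet_slope m b c := (1 + b * c `^ (- m)) `^ (m^-1 - 1).

Lemma powR_factor m b c : 0 < c ->
  c `^ m + b = (1 + b * c `^ (- m)) * c `^ m.
Proof.
move=> c0; rewrite mulrDl mul1r powRN -mulrA mulVf ?mulr1//.
by rewrite gt_eqF// powR_gt0.
Qed.

Lemma powR_factor_gt0 m b c : 0 < c -> 0 < c `^ m + b ->
  0 < 1 + b * c `^ (- m).
Proof. by move=> c0; rewrite powR_factor// pmulr_lgt0// powR_gt0. Qed.

(** The chain rule gives [(c^m + b)^(1/m - 1) * c^(m - 1)]. Factoring [c^m] out of the bracket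
    produces [c^(1 - m)], which cancels the last factor. *)
Lemma is_derive_outlet_map m b c : m != 0 -> 0 < c -> 0 < c `^ m + b ->
  is_derive c 1 (outlet_map m b) (outlet_slope m b c).
Proof.
move=> m0 c0 cb0.
have h : is_derive c 1 (fun c => c `^ m + b) (m * c `^ (m - 1)).
  rewrite -[X in is_derive _ _ _ X]addr0.
  exact: (is_deriveD (is_derive1_powR m c0) (is_derive_cst b c 1)).
have := @is_derive1_comp _ (fun y => y `^ m^-1) (fun c => c `^ m + b) c _ _
  (is_derive1_powR m^-1 cb0) h.
rewrite /comp => /is_derive_eq; apply.
rewrite mulrACA mulVf// mul1r powR_factor//.
rewrite powRM ?powR_ge0//; last exact/ltW/powR_factor_gt0.
rewrite -powRrM -mulrA -powRD; last by rewrite (gt_eqF c0) implybT.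
rewrite mulrBr mulfV// mulr1.
by rewrite (_ : 1 - m + (m - 1) = 0) ?powRr0 ?mulr1//; ring.
Qed.

Lemma ler_powR_neg m x y : m <= 0 -> 0 < x -> x <= y -> y `^ m <= x `^ m.
Proof.
move=> m0 x0 xy; have y0 : 0 < y by lra.
rewrite -[m]opprK !(powRN _ (- m)) lef_pV2 ?posrE ?powR_gt0//.
by apply: ge0_ler_powR; rewrite ?nnegrE ?oppr_ge0//; lra.
Qed.

Lemma ler_powR_pos m x y : 0 <= m -> 0 < x -> x <= y -> x `^ m <= y `^ m.
Proof. by move=> m0 x0 xy; apply: ge0_ler_powR; rewrite ?nnegrE//; lra. Qed.

(** As [c] grows, [c^(-m)] decreases and [b <= 0] reverses this, so the base increases from a
    positive value; the exponent [1/m - 1] is nonnegative. *)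
Lemma outlet_slope_nondecreasing m b x y : 0 < m <= 1 -> b <= 0 ->
  0 < x -> 0 < x `^ m + b -> x <= y -> outlet_slope m b x <= outlet_slope m b y.
Proof.
move=> /andP[m0 m1] b0 x0 xb0 xy; apply: ler_powR_pos.
- by rewrite subr_ge0 invf_ge1.
- exact: powR_factor_gt0.
- rewrite lerD2l ler_wnM2l//; apply: ler_powR_neg => //; lra.
Qed.

(** Here the base increases with [c], but the exponent [1/m - 1] is negative. *)
Lemma outlet_slope_nonincreasing m b x y : m < 0 -> 0 <= b ->
  0 < x -> x <= y -> outlet_slope m b y <= outlet_slope m b x.
Proof.
move=> m0 b0 x0 xy; apply: ler_powR_neg.
- have : m^-1 < 0 by rewrite invr_lt0. lra.
- by apply: powR_factor_gt0 => //; have := powR_gt0 m x0; lra.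
- rewrite lerD2l ler_wpM2l//; apply: ler_powR_pos => //; lra.
Qed.

(** The reaction only consumes. Writing [c] as [(c^m)^(1/m)], the shift by [b] goes up exactly when
    the outer power is decreasing. *)
Lemma outlet_map_le m b c : m != 0 -> m * b <= 0 -> 0 < c -> 0 < c `^ m + b ->
  outlet_map m b c <= c.
Proof.
move=> m0 mb c0 cb0.
rewrite -[leRHS](_ : (c `^ m) `^ m^-1 = c); last first.
  by rewrite -powRrM mulfV// powRr1// ltW.
case: (ltgtP m 0) m0 => // mlt0 _.
  by apply: ler_powR_neg; rewrite ?invr_le0 ?powR_gt0 ?(ltW mlt0)//; nra.
by apply: ler_powR_pos; rewrite ?invr_ge0 ?(ltW mlt0)//; nra.
Qed.

End outlet_map.

(** * Translation invariance of the completed Lebesgue measure *)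

Section completed_lebesgue_translation.
Context {R : realType}.
Implicit Types (A : set R) (s t : R).
Local Notation T := (lebesgueTypeR R).
Local Notation mu := (@completed_lebesgue_measure R).

(** Translating a cover of [A] by half-open intervals gives a cover of the translated set with the
    same total length, and the measure is the infimum over such covers. *)
Local Lemma le_completed_lebesgue_translate (A : set R) (s : R) :
  (mu [set t : R | A (t + s)%R] <= mu A)%E.
Proof.
apply: le_ereal_inf_tmp => _ [F [mF AF] <-].
apply: ereal_inf_lbound; exists (fun i => [set t | F i (t + s)]).
  split=> [i|t /AF[i _ Fi]]; last by exists i.
  have [[x y] _ /= <-] := mF i; exists (x - s, y - s) => //=.
  by apply/seteqP; split=> t /=; rewrite !in_itv/=; lra.
apply: eq_eseriesr => i _; have [[x y] _ /= <-] := mF i.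
rewrite (_ : [set t | _] = `]x - s, y - s]%classic); last first.
  by apply/seteqP; split=> t /=; rewrite !in_itv/=; lra.
have [xy|yx] := leP x y.
  by rewrite !wlength_itv_bnd//=; [congr EFin; ring|lra].
by rewrite !set_itv_ge ?bnd_simp//; lra.
Qed.

Lemma completed_lebesgue_measure_translate (A : set R) (s : R) :
  mu [set t | A (t + s)] = mu A.
Proof.
apply/eqP; rewrite eq_le le_completed_lebesgue_translate/=.
have := le_completed_lebesgue_translate [set t | A (t + s)] (- s).
by under eq_set do rewrite /= subrK.
Qed.

(** Carathéodory's splitting criterion, which is the definition of this sigma-algebra up to
    conversion. *)
Local Lemma lebesgue_measurableP A : lebesgue_measurable A <->
  forall X : set R, mu X = (mu (X `&` A) + mu (X `&` ~` A))%E.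
Proof. by []. Qed.

Lemma lebesgue_measurable_translate A s :
  lebesgue_measurable A -> lebesgue_measurable [set t | A (t + s)].
Proof.
move=> /lebesgue_measurableP mA; apply/lebesgue_measurableP => X.
have XE : X = [set t | [set t | X (t - s)] (t + s)].
  by apply/seteqP; split=> t /=; rewrite addrK.
rewrite {1}XE completed_lebesgue_measure_translate mA.
congr (_ + _)%E.
  rewrite -(completed_lebesgue_measure_translate _ s); congr (mu _).
  by apply/seteqP; split=> t /=; rewrite addrK.
rewrite -(completed_lebesgue_measure_translate _ s); congr (mu _).
by apply/seteqP; split=> t /=; rewrite addrK.
Qed.

(** The target also carries the Lebesgue sigma-algebra, so this is stronger than Borel measurability
    and allows composition with any Lebesgue-measurable function. *)
Lemma measurable_fun_translate (s : R) :
  measurable_fun [set: T] (fun t : T => (t : R) + s : T).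
Proof.
move=> _ A mA; rewrite setTI; exact: lebesgue_measurable_translate.
Qed.

Lemma lebesgue_measurable_itv (i : interval R) : lebesgue_measurable [set` i].
Proof. by apply: sub_caratheodory; exact: measurable_itv. Qed.

End completed_lebesgue_translation.

(** * Means over a period: linearity, monotonicity, invariance under delay *)

Section mean_theory.
Context {R : realType}.
Local Notation T := (lebesgueTypeR R).
Local Notation mu := (@completed_lebesgue_measure R).
Implicit Types (f g : R -> R) (s t tau M N : R).

Lemma completed_lebesgue_measure_itvcc tau : 0 <= tau ->
  mu `[0, tau]%classic = tau%:E.
Proof.
move=> tau0; transitivity (@lebesgue_measure R `[0, tau]%classic); first by [].
rewrite lebesgue_measure_itv/= lte_fin.
by case: (ltgtP 0 tau) tau0 => //= [_|<-] _; rewrite ?sube0.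
Qed.

Lemma completed_lebesgue_measure_set1 t : mu [set t] = 0%E.
Proof. exact: lebesgue_measure_set1. Qed.

Lemma bounded_lebesgue_integrable {tau f M} : 0 <= tau ->
  lebesgue_measurable_fun f -> (forall t, `|f t| <= M) ->
  mu.-integrable `[0, tau] (EFin \o f).
Proof.
move=> tau0 mf fM; apply: measurable_bounded_integrable.
- exact: lebesgue_measurable_itv.
- by rewrite [ltLHS]completed_lebesgue_measure_itvcc ?ltry.
- exact: measurable_funTS mf.
- exists M; split; first exact: num_real.
  by move=> x Mx t _ /=; rewrite (le_trans (fM t))// ltW.
Qed.

Lemma mean_cst {tau} (c : R) : 0 < tau -> mean tau (fun=> c) = c.
Proof.
move=> tau0; rewrite /mean Rintegral_cst; last exact: lebesgue_measurable_itv.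
rewrite [X in fine X]completed_lebesgue_measure_itvcc ?ltW//=.
by rewrite mulrCA mulVf ?mulr1// gt_eqF.
Qed.

Lemma mean_affine {tau f M} (a b : R) : 0 < tau ->
  lebesgue_measurable_fun f -> (forall t, `|f t| <= M) ->
  mean tau (fun t => a * f t + b) = a * mean tau f + b.
Proof.
move=> tau0 mf fM.
have itf := bounded_lebesgue_integrable (ltW tau0) mf fM.
have mD := @lebesgue_measurable_itv R `[0, tau].
rewrite -[in RHS](mean_cst b tau0) /mean RintegralD//.
- by rewrite RintegralZl// mulrDr mulrCA.
- exact: (@integrableZl _ _ _ mu _ mD a _ itf).
- by apply: (@bounded_lebesgue_integrable _ (cst b) `|b|) => //;
    [exact: ltW|exact: measurable_cst].
Qed.

Lemma le_mean {tau f g M N} : 0 < tau ->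
  lebesgue_measurable_fun f -> (forall t, `|f t| <= M) ->
  lebesgue_measurable_fun g -> (forall t, `|g t| <= N) ->
  (forall t, f t <= g t) -> mean tau f <= mean tau g.
Proof.
move=> tau0 mf fM mg gN fg; rewrite ler_pM2l ?invr_gt0//.
apply: le_Rintegral => //; first exact: lebesgue_measurable_itv.
- exact: bounded_lebesgue_integrable (ltW tau0) mf fM.
- exact: bounded_lebesgue_integrable (ltW tau0) mg gN.
Qed.

(** The removed endpoint is a null set. Half-open periods can be cut and translated without
    overlap. *)
Lemma mean_itvco {tau f M} : 0 <= tau ->
  lebesgue_measurable_fun f -> (forall t, `|f t| <= M) ->
  mean tau f = tau^-1 * \int[mu]_(t in `[0, tau[) f t.
Proof.
move=> tau0 mf fM; congr (_ * fine _).
have -> : `[0, tau[%classic = `[0, tau]%classic `\` [set tau].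
  apply/seteqP; split=> t /=; rewrite !in_itv/=.
    by move=> ?; split; [|apply/eqP]; lra.
  by move=> [? /eqP]; lra.
apply: (@negligible_integral _ T _ mu _ _ (EFin \o f)).
- by rewrite -set_itv1; exact: lebesgue_measurable_itv.
- exact: lebesgue_measurable_itv.
- exact: bounded_lebesgue_integrable tau0 mf fM.
- exact: completed_lebesgue_measure_set1.
Qed.

(** By translation invariance [mu] is its own pushforward, so this is the change of variables along
    a translation. *)
Lemma ge0_integral_translate {f} {D : set R} s :
  lebesgue_measurable D -> lebesgue_measurable_fun f -> (forall t, 0 <= f t) ->
  (\int[mu]_(t in [set t | D (t + s)%R]) (f (t + s)%R)%:E =
   \int[mu]_(t in D) (f t)%:E)%E.
Proof.
move=> mD mf f0.
rewrite [in RHS](_ : mu = pushforward mu (fun t : T => (t : R) + s : T)).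
  rewrite ge0_integral_pushforward; [by []|exact: measurable_fun_translate|
    exact: mD|exact/measurable_EFinP/measurable_funTS|].
  by move=> t _; rewrite lee_fin.
by apply/funext => A; rewrite -(completed_lebesgue_measure_translate A s).
Qed.

Lemma lebesgue_measurable_fun_translate {f} s :
  lebesgue_measurable_fun f -> lebesgue_measurable_fun (fun t => f (t + s)).
Proof. by move=> mf; exact: measurableT_comp mf (measurable_fun_translate s). Qed.

Lemma ge0_integral_itv_split {f} {a b c : R} : a <= b -> b <= c ->
  lebesgue_measurable_fun f -> (forall t, 0 <= f t) ->
  (\int[mu]_(t in `[a, c[) (f t)%:E =
   \int[mu]_(t in `[a, b[) (f t)%:E + \int[mu]_(t in `[b, c[) (f t)%:E)%E.
Proof.
move=> ab bc mf f0; rewrite -ge0_integral_setU.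
- congr (integral _ _ _); apply/seteqP; split=> t /=; rewrite !in_itv/=;
  [case: (ltP t b) => tb ?; [left|right]|move=> []]; lra.
- exact: lebesgue_measurable_itv.
- exact: lebesgue_measurable_itv.
- exact/measurable_EFinP/measurable_funTS.
- by move=> t _; rewrite lee_fin.
- by apply/disj_setPS => t [/=]; rewrite !in_itv/=; lra.
Qed.

Lemma periodic_int {f tau} : periodic f tau ->
  forall (k : int) t, f (t + k%:~R * tau) = f t.
Proof.
move=> fp [k|k] t; first by rewrite -pmulrn mulr_natl periodicn.
by rewrite NegzE mulrNz -pmulrn mulNr mulr_natl -(periodicn fp k.+1) subrK.
Qed.

Lemma floor_translate_itv t {tau} : 0 < tau ->
  0 <= t - (Num.floor (t / tau))%:~R * tau < tau.
Proof.
move=> tau0; have /andP[le_t t_lt] := floor_itv (t / tau).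
move: le_t t_lt; rewrite ler_pdivlMr// ltr_pdivrMr// intrD; lra.
Qed.

(* Only the residue [r] of [s] modulo [tau] matters; the pieces [[0, r[] and
   [[r, tau[] of the period get swapped by the translation. *)
Lemma mean_translate {tau f M} s : 0 < tau ->
  lebesgue_measurable_fun f -> (forall t, 0 <= f t <= M) -> periodic f tau ->
  mean tau (fun t => f (t + s)) = mean tau f.
Proof.
move=> tau0 mf f0M fp.
have f0 t : 0 <= f t by have /andP[] := f0M t.
have fM t : `|f t| <= M by rewrite ger0_norm//; have /andP[] := f0M t.
have := floor_translate_itv s tau0; set r := s - _ => /andP[r0 rtau].
have -> : (fun t => f (t + s)) = (fun t => f (t + r)).
  apply/funext => t; rewrite -(periodic_int fp (Num.floor (s / tau)) (t + r)).
  by rewrite /r addrA subrK.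
have mfr := lebesgue_measurable_fun_translate r mf.
rewrite (mean_itvco (ltW tau0) mf fM).
rewrite (mean_itvco (ltW tau0) mfr (fun t => fM (t + r))).
congr (_ * fine _).
have ge0_shift a b c : (\int[mu]_(t in `[a, b[) (f (t + c)%R)%:E =
    \int[mu]_(t in `[(a + c)%R, (b + c)%R[) (f t)%:E)%E.
  rewrite -(ge0_integral_translate c (lebesgue_measurable_itv _) mf f0).
  congr (integral _ _ _); apply/seteqP; split=> t /=; rewrite !in_itv/=; lra.
rewrite (ge0_integral_itv_split (b := tau - r) _ _ mfr); [|lra..|by []].
rewrite (ge0_integral_itv_split (b := r) _ _ mf f0); [|lra..].
rewrite [LHS]addeC [X in (_ + X)%E = _]ge0_shift add0r subrK; congr (_ + _)%E.
(* Shifted by [r], this piece would land on [[tau, tau + r[]; periodicity replaces the shift by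
   [r - tau], which lands on [[0, r[]. *)
transitivity (\int[mu]_(t in `[(tau - r)%R, tau[) (f (t + (r - tau))%R)%:E)%E.
  by apply: eq_integral => t _; rewrite -(fp (t + (r - tau))); do 2 f_equal; ring.
rewrite ge0_shift (_ : tau - r + (r - tau) = 0); last by ring.
by rewrite (_ : tau + (r - tau) = r)//; ring.
Qed.

End mean_theory.

(** * Periodic extensions and bang-bang controls *)

Section periodic_extension_theory.
Context {R : realType}.
Local Notation mu := (@completed_lebesgue_measure R).
Implicit Types (u : R -> R) (A : set R) (t tau M Cmin Cmax : R).

Lemma periodic_extension_id u {tau t} : 0 < tau -> 0 <= t < tau ->
  periodic_extension tau u t = u t.
Proof.
move=> tau0 /andP[t0 ttau]; rewrite /periodic_extension.
rewrite (@floor_def _ (t / tau) 0) ?mul0r ?subr0//.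
by rewrite divr_ge0 ?(ltW tau0)//= ltr_pdivrMr// mul1r.
Qed.

Lemma periodic_extension_periodic u {tau} : 0 < tau ->
  periodic (periodic_extension tau u) tau.
Proof.
move=> tau0 t; rewrite /periodic_extension mulrDl mulfV ?gt_eqF//.
rewrite floorDrz ?rpred1// floor1 intrD mulrDl mul1r.
by congr u; ring.
Qed.

(** On the [k]-th period the floor is [k], so a preimage is a countable union of translated
    preimages under [u], each cut down to one period. *)
Lemma lebesgue_measurable_fun_periodic_extension {u tau} : 0 < tau ->
  lebesgue_measurable_fun u -> lebesgue_measurable_fun (periodic_extension tau u).
Proof.
move=> tau0 mut _ B mB; rewrite setTI.
have -> : periodic_extension tau u @^-1` B = \bigcup_(k : int)
    (`[k%:~R * tau, (k + 1)%:~R * tau[%classic `&`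
     [set t | [set t | B (u t)] (t + (- (k%:~R * tau)))]).
  apply/seteqP; split=> t /=.
    move=> But; exists (Num.floor (t / tau)) => //; split=> //=.
    rewrite in_itv/= -ler_pdivlMr// -ltr_pdivrMr//.
    exact: floor_itv.
  move=> [k _ /= []]; rewrite in_itv/= -ler_pdivlMr// -ltr_pdivrMr//.
  by move=> /floor_def kE; rewrite /periodic_extension kE.
apply: countable_bigcupT_measurable => [|k]; first exact: countableP.
apply: measurableI.
  exact: lebesgue_measurable_itv.
apply: lebesgue_measurable_translate.
by have := mut measurableT B mB; rewrite setTI.
Qed.

Lemma mean_periodic_extension {u tau M} : 0 < tau ->
  lebesgue_measurable_fun u -> (forall t, `|u t| <= M) ->
  mean tau (periodic_extension tau u) = mean tau u.
Proof.
move=> tau0 mut uM; 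
have mpu := lebesgue_measurable_fun_periodic_extension tau0 mut.
(* At [t = tau] the extension takes the value [u 0], so the two functions are compared on the
   half-open period. *)
rewrite (mean_itvco (ltW tau0) mut uM).
rewrite (mean_itvco (ltW tau0) mpu (fun t => uM _)).
congr (_ * _); apply: eq_Rintegral => t; rewrite inE/= in_itv/=.
exact: periodic_extension_id.
Qed.

(** Being affine in an indicator reduces measurability and mean to those of [\1_A]. *)
Lemma bang_bangE Cmin Cmax A t :
  bang_bang Cmin Cmax A t = (Cmin - Cmax) * \1_A t + Cmax.
Proof.
by rewrite /bang_bang indicE; case: ifP => _; rewrite ?mulr1 ?subrK ?mulr0 ?add0r.
Qed.

Lemma bang_bang_itv {Cmin Cmax} A t : Cmin <= Cmax ->
  Cmin <= bang_bang Cmin Cmax A t <= Cmax.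
Proof. by rewrite /bang_bang => le; case: ifP => _; rewrite lexx le. Qed.

Lemma lebesgue_measurable_fun_indic {A} : lebesgue_measurable A ->
  lebesgue_measurable_fun (\1_A : R -> R).
Proof. by move=> mA; apply: measurable_indic. Qed.

Lemma lebesgue_measurable_fun_bang_bang Cmin Cmax A : lebesgue_measurable A ->
  lebesgue_measurable_fun (bang_bang Cmin Cmax A).
Proof.
move=> mA; rewrite (_ : bang_bang _ _ _ = fun t => (Cmin - Cmax) * \1_A t + Cmax).
  apply: measurable_funD; last exact: measurable_cst.
  apply: measurable_funM; first exact: measurable_cst.
  exact: lebesgue_measurable_fun_indic.
by apply/funext => t; exact: bang_bangE.
Qed.

Lemma mean_bang_bang Cmin Cmax A tau : 0 < tau -> lebesgue_measurable A ->
  A `<=` `[0, tau[ ->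
  mean tau (bang_bang Cmin Cmax A) = (Cmin - Cmax) * (tau^-1 * fine (mu A)) + Cmax.
Proof.
move=> tau0 mA A0.
rewrite (_ : bang_bang _ _ _ = fun t => (Cmin - Cmax) * \1_A t + Cmax); last first.
  by apply/funext => t; exact: bang_bangE.
rewrite (mean_affine _ _ tau0 (lebesgue_measurable_fun_indic mA) (M := 1)).
  congr (_ * (_ * fine _) + _).
  rewrite integral_indic//; last exact: lebesgue_measurable_itv.
  congr (mu _); apply/setIidl => t /A0 /=; rewrite !in_itv/=; lra.
by move=> t; rewrite indicE; case: (_ \in _); rewrite ?normr1 ?normr0.
Qed.

End periodic_extension_theory.

(** * Costs and supporting lines *)

Section outlet_concentration.
Context {R : realType}.
Implicit Types (u w : R -> R) (L v k n tau c alpha beta Cmin Cmax Cbar : R).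

(** The weak solution at [L] sees the control only through its value at [t - L / v]. Freezing that
    value as a constant control gives the map [G] for all [n] at once, convertible with
    [weak_solution] at the delayed value. *)
Definition outlet L v k n c := weak_solution v k n (cst c) L 0.

Lemma outlet_neq1 L v k n c : n != 1 ->
  outlet L v k n c = outlet_map (1 - n) (k * (n - 1) / v * L) c.
Proof.
by move=> n1; rewrite /outlet /weak_solution (negbTE n1) -invrN opprB.
Qed.

Lemma outlet_ge0 L v k n c : 0 <= c -> 0 <= outlet L v k n c.
Proof.
by move=> c0; rewrite /outlet /weak_solution; case: ifP => _;
  rewrite ?powR_ge0// mulr_ge0// expR_ge0.
Qed.

Lemma measurable_outlet L v k n : measurable_fun [set: R] (outlet L v k n).
Proof.
rewrite /outlet /weak_solution; case: (n == 1).
  by apply: measurable_funM; [exact: measurable_id|exact: measurable_cst].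
apply: (@measurableT_comp _ _ _ _ _ _ (@powR R ^~ (- (n - 1)^-1)) _
  (fun c => c `^ (- (n - 1)) + k * (n - 1) / v * L)) => //.
apply: measurable_funD; last exact: measurable_cst.
exact: measurable_powR.
Qed.

(** Removes the transport delay [L / v] from the cost: a delayed control keeps its bounds and, by
    periodicity, its mean. *)
Lemma admissible_translate {Cmin Cmax Cbar tau w} s : 0 < tau -> 0 < Cmin ->
  admissible Cmin Cmax Cbar tau w ->
  [/\ lebesgue_measurable_fun (fun t => w (t + s)),
      forall t, Cmin <= w (t + s) <= Cmax,
      forall t, `|w (t + s)| <= Cmax
    & mean tau (fun t => w (t + s)) = Cbar].
Proof.
move=> tau0 Cmin0 [mw pw wb <-].
have w0 t : 0 <= w t <= Cmax by have := wb t; lra.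
split=> //; first exact: lebesgue_measurable_fun_translate.
- by move=> t; rewrite ger0_norm; have := w0 (t + s); lra.
- exact: mean_translate w0 pw.
Qed.

(* The upper bound [c] only serves to make the cost integrand integrable. *)
Lemma le_cost {L v k n tau Cmin Cmax Cbar alpha beta w} :
  0 < v -> 0 < tau -> 0 < Cmin ->
  (forall c, Cmin <= c <= Cmax ->
    alpha * c + beta <= outlet L v k n c <= c) ->
  admissible Cmin Cmax Cbar tau w ->
  v * alpha * Cbar + v * beta <= cost L v k n tau w.
Proof.
move=> v0 tau0 Cmin0 aff.
move=> /(admissible_translate (- (L / v)) tau0 Cmin0)[mw wb wM <-].
(* [Cbar] has become the mean of the delayed control, so the bound is the mean of an affine function
   of it and can be compared pointwise with the cost integrand. *)
rewrite -(mean_affine _ _ tau0 mw wM).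
have mg : lebesgue_measurable_fun
    (fun t => outlet L v k n (w (t - L / v)) * v).
  apply: measurable_funM; last exact: measurable_cst.
  exact: measurableT_comp (measurable_outlet L v k n) mw.
have ma : lebesgue_measurable_fun (fun t => v * alpha * w (t - L / v) + v * beta).
  apply: measurable_funD; last exact: measurable_cst.
  by apply: measurable_funM => //; exact: measurable_cst.
apply: (le_mean (M := `|v * alpha| * Cmax + `|v * beta|) (N := Cmax * v) tau0 ma _ mg).
- move=> t; rewrite (le_trans (ler_normD _ _))// lerD2r normrM ler_wpM2l//.
- move=> t; have := aff _ (wb t) => /andP[_ wle]; have wt := wb t.
  rewrite ger0_norm ?mulr_ge0 ?outlet_ge0 ?(ltW v0)//; last lra.
  by rewrite ler_wpM2r ?(ltW v0)//; lra.
- move=> t; have /andP[lew _] := aff _ (wb t).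
  change (v * alpha * w (t - L / v) + v * beta <= outlet L v k n (w (t - L / v)) * v).
  by nra.
Qed.

(** The affine relation is asked only at values taken by [u]. It thus serves both [n = 1], where it
    holds everywhere, and controls that stay at contact points of a supporting line. *)
Lemma eq_cost {L v k n tau Cmin Cmax Cbar alpha beta u} :
  0 < tau -> 0 < Cmin ->
  (forall t, outlet L v k n (u t) = alpha * u t + beta) ->
  admissible Cmin Cmax Cbar tau u ->
  cost L v k n tau u = v * alpha * Cbar + v * beta.
Proof.
move=> tau0 Cmin0 aff.
move=> /(admissible_translate (- (L / v)) tau0 Cmin0)[mut wb uM <-].
rewrite -(mean_affine _ _ tau0 mut uM) /cost; congr (mean _ _).
apply/funext => t; transitivity (outlet L v k n (u (t - L / v)) * v) => //.
by rewrite aff; ring.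
Qed.

(** The value [v * (alpha * Cbar + beta)] bounds every admissible cost from below and is attained by
    [u]. *)
Lemma optimal_supporting_line {L v k n tau Cmin Cmax Cbar alpha beta u} :
  0 < v -> 0 < tau -> 0 < Cmin ->
  (forall c, Cmin <= c <= Cmax ->
    alpha * c + beta <= outlet L v k n c <= c) ->
  (forall t, outlet L v k n (u t) = alpha * u t + beta) ->
  admissible Cmin Cmax Cbar tau u ->
  optimal L v k n Cmin Cmax Cbar tau u.
Proof.
move=> v0 tau0 Cmin0 aff eqa uad; split; first exact: uad.
move=> w wad.
rewrite (@eq_cost L v k n _ _ _ _ _ _ _ tau0 Cmin0 eqa uad).
exact: le_cost aff wad.
Qed.

End outlet_concentration.

(** * The three regimes of the reaction order *)

Theorem theorem2p1 (R : realType) (L v k n tau Cmin Cmax Cbar : R)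
    (L_gt0 : 0 < L) (v_gt0 : 0 < v) (k_gt0 : 0 < k) (n_gt0 : 0 < n)
    (tau_gt0 : 0 < tau) (Cmin_gt0 : 0 < Cmin) (Cmin_lt_Cmax : Cmin < Cmax)
    (Cbar_bounds : Cmin <= Cbar <= Cmax) :
  [/\ n = 1 ->
        forall u w : R -> R,
          admissible Cmin Cmax Cbar tau u ->
          admissible Cmin Cmax Cbar tau w ->
          cost L v k n tau u = cost L v k n tau w,
      n < 1 ->
        (v / (k * L * (1 - n))) `^ (- (1 - n)^-1) < Cmin ->
        optimal L v k n Cmin Cmax Cbar tau (fun _ : R => Cbar)
    & 1 < n ->
        forall Aminus : set R,
          lebesgue_measurable Aminus ->
          Aminus `<=` `[0, tau[ ->
          completed_lebesgue_measure Aminus =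
            ((Cmax - Cbar) / (Cmax - Cmin) * tau)%:E ->
          optimal L v k n Cmin Cmax Cbar tau
            (periodic_extension tau (bang_bang Cmin Cmax Aminus))].
Proof.
set m := 1 - n; set b := k * (n - 1) / v * L.
split=> [n1 u w uad wad|n_lt1 Cmin_gt|n_gt1 A mA A0 muA].
- have aff c : outlet L v k n c = expR (- (k / v) * L) * c + 0.
    by rewrite /outlet /weak_solution n1 eqxx mulrC addr0.
  rewrite (eq_cost tau_gt0 Cmin_gt0 (fun t => aff (u t)) uad).
  by rewrite (eq_cost tau_gt0 Cmin_gt0 (fun t => aff (w t)) wad).
- have GE c : outlet L v k n c = outlet_map m b c.
    by apply: outlet_neq1; rewrite lt_eqF.
  have m0 : 0 < m by rewrite subr_gt0.
  have m1 : m <= 1 by rewrite /m; lra.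
  have b0 : b < 0.
    by rewrite /b -mulrA nmulr_rlt0 ?mulr_gt0 ?invr_gt0// pmulr_rlt0//; lra.
  (* The lower bound on [Cmin] says exactly that [- b < Cmin `^ m]. *)
  have bE : - b = ((v / (k * L * m)) `^ (- m^-1)) `^ m.
    rewrite -powRrM mulNr mulVf ?gt_eqF// powR_inv1; last first.
      by rewrite divr_ge0 ?mulr_ge0 ?ltW.
    by rewrite invf_div /b /m; field; rewrite gt_eqF.
  clearbody m b.
  (* The bracket stays positive on the admissible range, so the value of [powR] at negative bases
     never enters. *)
  have pos c : Cmin <= c -> 0 < c `^ m + b.
    move=> cge; rewrite -[b]opprK subr_gt0 bE.
    by rewrite gt0_ltr_powR ?nnegrE ?powR_ge0//; lra.
  have dG x : Cmin <= x <= Cmax ->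
      is_derive x 1 (outlet_map m b) (outlet_slope m b x).
    move=> /andP[xge _]; apply: is_derive_outlet_map; [|lra|exact: pos].
    by rewrite gt_eqF.
  have Gmono x y : Cmin <= x -> x <= y -> y <= Cmax ->
      outlet_slope m b x <= outlet_slope m b y.
    move=> xge xy _; apply: outlet_slope_nondecreasing;
      [exact/andP|exact: ltW|lra|exact: pos|exact: xy].
  have Gconvex c := nondecreasing_derive_ge_tangent dG Gmono Cbar c Cbar_bounds.
  (* The line is the tangent at [Cbar], which the steady control touches at all times. *)
  apply: (@optimal_supporting_line _ _ _ _ _ _ _ _ _ (outlet_slope m b Cbar)
    (outlet_map m b Cbar - outlet_slope m b Cbar * Cbar)
    _ v_gt0 tau_gt0 Cmin_gt0).
  + move=> c cb; rewrite GE; apply/andP; split.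
      by apply: le_trans (Gconvex c cb); rewrite mulrBr addrCA.
    move/andP: cb => [cge _].
    apply: outlet_map_le; [by rewrite gt_eqF| |lra|exact: pos].
    by rewrite pmulr_rle0// ltW.
  + by move=> _; rewrite GE [RHS]addrC subrK.
  + split; [exact: measurable_cst|by []|by []|exact: mean_cst].
- have GE c : outlet L v k n c = outlet_map m b c.
    by apply: outlet_neq1; rewrite gt_eqF.
  have m0 : m < 0 by rewrite subr_lt0.
  have b0 : 0 < b by rewrite !mulr_gt0 ?invr_gt0//; lra.
  clearbody m b.
  have pos c : 0 < c `^ m + b by rewrite ltr_wpDl ?powR_ge0.
  have dG x : Cmin <= x <= Cmax ->
      is_derive x 1 (outlet_map m b) (outlet_slope m b x).
    move=> /andP[xge _]; apply: is_derive_outlet_map => //.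
      by rewrite lt_eqF.
    exact: lt_le_trans xge.
  have Gmono x y : Cmin <= x -> x <= y -> y <= Cmax ->
      outlet_slope m b y <= outlet_slope m b x.
    move=> xge xy _; apply: outlet_slope_nonincreasing => //; first exact: ltW.
    exact: lt_le_trans xge.
  have Gconcave := nonincreasing_derive_ge_chord Cmin_lt_Cmax dG Gmono.
  (* The intercept chosen below makes the chord meet the outlet map at [Cmin]; this identity makes
     it meet at [Cmax], the other value of the control. *)
  have alphaE : (outlet_map m b Cmax - outlet_map m b Cmin) / (Cmax - Cmin)
      * (Cmax - Cmin) = outlet_map m b Cmax - outlet_map m b Cmin.
    by rewrite mulfVK// subr_eq0 gt_eqF.
  move: (_ / _) alphaE Gconcave => alpha alphaE Gconcave.
  have mbb := lebesgue_measurable_fun_bang_bang Cmin Cmax A mA.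
  apply: (@optimal_supporting_line _ _ _ _ _ _ _ _ _ alpha
    (outlet_map m b Cmin - alpha * Cmin)
    _ v_gt0 tau_gt0 Cmin_gt0).
  + move=> c cb; rewrite GE; apply/andP; split.
      by apply: le_trans (Gconcave c cb); rewrite mulrBr addrCA.
    move/andP: cb => [cge _].
    apply: outlet_map_le; [by rewrite lt_eqF| |exact: lt_le_trans cge|exact: pos].
    by rewrite nmulr_rle0// ltW.
  + move=> t; rewrite GE /periodic_extension /bang_bang; case: ifP => _.
      by rewrite [RHS]addrC subrK.
    by rewrite [RHS]addrCA -mulrBr alphaE addrC subrK.
  + split; [exact: lebesgue_measurable_fun_periodic_extension|
      exact: periodic_extension_periodic|
      by move=> t; exact: bang_bang_itv (ltW Cmin_lt_Cmax)|].
    rewrite (@mean_periodic_extension _ _ _ Cmax)//; last first.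
      move=> t; have /andP[ge_t le_t] := bang_bang_itv A t (ltW Cmin_lt_Cmax).
      by rewrite ger0_norm// (le_trans (ltW Cmin_gt0)).
    (* The prescribed measure of [A] turns the mean into [Cmax - (Cmax - Cbar)]. *)
    rewrite mean_bang_bang// muA/=; field.
    by rewrite subr_eq0 !gt_eqF.
Qed.
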